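(* Let $G$ be a finite graph without loops and without multiple edges on vertex set $\{v_1,\dots,v_n\}$, such that no two distinct neighbours of $v_1$ are adjacent. Consider the synchronous dynamics described in the context, where $v_1$ has an arbitrary update rule and every $v_i$, $i\ge2$, has a threshold rule. Then from any initial state the system eventually reaches a cycle of length $1$, $2$ or $4$; that is, there exist $T$ and $p\in\{1,2,4\}$ with $U_{t+p}=U_t$ for all $t\ge T$, $p$ being the least positive integer with this property.
   Context: For each $i$, $N_i$ denotes the neighbourhood of $v_i$ (including $v_i$ iff there is a loop at $v_i$). Each vertex holds an opinion in $\{+1,-1\}$; $U_t$ is the set of vertices with opinion $+1$ at time $t$, with $U_0$ arbitrary. All vertices update simultaneously: for each $i$ there is a family $\mathcal S_i$ of subsets of $N_i$ such that $v_i\in U_{t+1}$ iff $N_i\cap U_t\in\mathcal S_i$. The rule $\mathcal S_1$ at $v_1$ is arbitrary; for $i\ge2$, $v_i$ has a threshold rule: $\mathcal S_i=\{A\subseteq N_i:|A|\ge r_i\}$ for some integer $r_i$. *)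

(* Defs.v *)
From mathcomp Require Import all_boot all_order all_algebra.

Set Implicit Arguments.
Unset Strict Implicit.
Unset Printing Implicit Defensive.

(* A graph on the finite type V is its adjacency relation e; v has a loop iff
   e v v, in which case v belongs to its own neighbourhood. *)
Definition nbhd (V : finType) (e : rel V) (v : V) : {set V} := [set u | e v u].

(* S v is the family of sets of +1-neighbours that turn v into a +1-vertex. *)
Definition update_rule (V : finType) (e : rel V) (S : V -> {set {set V}}) : Prop :=
  forall v, S v \subset powerset (nbhd e v).

(* The threshold is an arbitrary integer, so it may be negative or exceed the
   degree of v, giving the two constant rules. *)
Definition threshold_rule (V : finType) (e : rel V) (S : V -> {set {set V}})
    (v : V) : Prop :=
  exists r : int,
    S v = [set A in powerset (nbhd e v) | (r <= (#|A|)%:Z)%R].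

(* A state is identified with the set of vertices holding opinion +1. *)
Definition step (V : finType) (e : rel V) (S : V -> {set {set V}})
    (U : {set V}) : {set V} :=
  [set v | nbhd e v :&: U \in S v].

Definition state (V : finType) (e : rel V) (S : V -> {set {set V}})
    (U0 : {set V}) (t : nat) : {set V} :=
  iter t (step e S) U0.

Definition periodic_from (X : Type) (U : nat -> X) (T p : nat) : Prop :=
  forall t, T <= t -> U (t + p) = U t.

Definition cycle_length_from (X : Type) (U : nat -> X) (T p : nat) : Prop :=
  [/\ 0 < p, periodic_from U T p
    & forall q, 0 < q -> periodic_from U T q -> p <= q].

(* Main.v *)
(** Remove [v1] and shift the threshold of each of its neighbours by one half, so
   that such a neighbour follows its remaining neighbours except in case of an
   exact tie, which the opinion of [v1] breaks.  The Goles-Olivos energy of the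
   graph without [v1] is then still nondecreasing, hence constant on the limit
   cycle, and so every vertex outside [v1] and its neighbourhood [N] has period
   dividing 2.  As [N] is independent, its state at time [t + 1] is determined by
   the parity of [t] and the opinion of [v1] at time [t]; so the opinion of [v1] at
   time [t + 2] is a function of its opinion at time [t], depending only on the
   parity of [t].  A self-map of a two-element set has cycles of length at most 2,
   whence a period dividing 4. *)
Require Import Defs.
From mathcomp Require Import all_boot all_order all_algebra.
From mathcomp Require Import zify ring.

Set Implicit Arguments.
Unset Strict Implicit.
Unset Printing Implicit Defensive.

Import Order.TTheory GRing.Theory Num.Theory.

Lemma periodic_from_mul (X : Type) (u : nat -> X) (T p k : nat) :
  periodic_from u T p -> periodic_from u T (k * p).
Proof.
move=> up t leTt; elim: k => [|k IHk]; first by rewrite addn0.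
by rewrite mulSn addnCA addnC up ?IHk // (leq_trans leTt) ?leq_addr.
Qed.

Lemma periodic_from_iter (X : Type) (f : X -> X) (x : X) (T p : nat) :
  iter (T + p) f x = iter T f x -> periodic_from (fun t => iter t f x) T p.
Proof. by move=> eqT t /subnK <-; rewrite -addnA iterD eqT -iterD. Qed.

Lemma iter_eventually_periodic (X : finType) (f : X -> X) (x : X) :
  exists N p : nat, 0 < p /\ periodic_from (fun t => iter t f x) N p.
Proof.
have /trajectP[N ltN eqN] := looping_order f x.
exists N, (fingraph.order f x - N); split; first by rewrite subn_gt0.
by apply: periodic_from_iter; rewrite subnKC // ltnW.
Qed.

Lemma cycle_length_iter4 (X : eqType) (f : X -> X) (x : X) (T : nat) :
  periodic_from (fun t => iter t f x) T 4 ->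
  exists p, p \in [:: 1; 2; 4] /\ cycle_length_from (fun t => iter t f x) T p.
Proof.
move=> per4; pose u t := iter t f x.
have [/eqP eq1|nper1] := boolP (u (T + 1) == u T).
  by exists 1; split=> //; split=> //; apply: periodic_from_iter.
have [/eqP eq2|nper2] := boolP (u (T + 2) == u T).
  exists 2; split=> //; split; [by []|exact: periodic_from_iter|].
  by move=> [|[|q]] // _ per1; rewrite /u per1 ?eqxx in nper1.
exists 4; split=> //; split=> // -[|[|[|[|q]]]] // _ perq.
- by rewrite /u perq ?eqxx in nper1.
- by rewrite /u perq ?eqxx in nper2.
(* Period 3 together with period 4 would give a fixed point: [u (T + 1) = u (T + 4) = u T]. *)
case/negP: nper1; rewrite /u -(perq (T + 1)) ?leq_addr // -addnA.
by rewrite per4.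
Qed.

Local Open Scope ring_scope.

Lemma nondecreasing_periodic_const (L : nat -> int) (N p : nat) :
  (0 < p)%N -> (forall t, L t <= L t.+1) -> periodic_from L N p ->
  forall t, (N <= t)%N -> L t.+1 = L t.
Proof.
move=> p_gt0 incL perL t leNt; apply/eqP; rewrite eq_le incL andbT.
have homoL := homo_leq (@lexx _ int) (@le_trans _ int) incL.
by rewrite -[leRHS](perL t leNt); apply: homoL; rewrite -addn1 leq_add2l.
Qed.

(** The Goles-Olivos energy with its sign reversed, [c] being minus the threshold. *)
Definition energy (V : finType) (P : pred V) (a : V -> V -> int) (c : V -> int)
    (x : nat -> V -> int) (t : nat) : int :=
  \sum_(i | P i) \sum_(j | P j) a i j * x t.+1 i * x t j
  + \sum_(i | P i) c i * (x t.+1 i + x t i).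

(** By symmetry of [a] the double sum at time [t] can be transposed, which pairs both energies with
    the same field at time [t.+1]. *)
Lemma energyB (V : finType) (P : pred V) (a : V -> V -> int) (c : V -> int)
    (x : nat -> V -> int) (t : nat) :
  (forall i j, a i j = a j i) ->
  energy P a c x t.+1 - energy P a c x t =
  \sum_(i | P i) (x t.+2 i - x t i)
                 * (\sum_(j | P j) a i j * x t.+1 j + c i).
Proof.
move=> a_sym; rewrite /energy [in X in _ - (X + _)]exchange_big /=.
rewrite opprD addrACA -!sumrB -big_split /=; apply: eq_bigr => i _.
rewrite -sumrB [RHS]mulrDr mulr_sumr; congr (_ + _); last by ring.
by apply: eq_bigr => j _; rewrite (a_sym j i); ring.
Qed.

(** The energy is nondecreasing and eventually periodic, hence constant from [N] on; its increment
    is then a vanishing sum of nonnegative drifts. *)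
Lemma goles_olivos (V : finType) (P : pred V) (a : V -> V -> int)
    (c : V -> int) (x : nat -> V -> int) (N p : nat)
    (drift := fun t i =>
       (x t.+2 i - x t i) * (\sum_(j | P j) a i j * x t.+1 j + c i)) :
  (forall i j, a i j = a j i) -> (0 < p)%N ->
  (forall i, periodic_from (x^~ i) N p) ->
  (forall t i, P i -> 0 <= drift t i) ->
  forall t i, (N <= t)%N -> P i -> drift t i = 0.
Proof.
move=> a_sym p_gt0 perx drift_ge0 t i leNt Pi.
have incE s : energy P a c x s <= energy P a c x s.+1.
  by rewrite -subr_ge0 energyB // sumr_ge0 // => k; apply: drift_ge0.
have perE : periodic_from (energy P a c x) N p.
  move=> s leNs; have xp k : x (s + p) k = x s k by exact: perx.
  have xSp k : x (s + p).+1 k = x s.+1 k by rewrite -addSn perx // leqW.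
  rewrite /energy; congr (_ + _); apply: eq_bigr => k _; last by rewrite xp xSp.
  by apply: eq_bigr => l _; rewrite xp xSp.
have /eqP := nondecreasing_periodic_const p_gt0 incE perE leNt.
rewrite -subr_eq0 energyB // => /eqP sum0.
exact: (psumr_eq0P (drift_ge0 t) sum0 Pi).
Qed.

Local Close Scope ring_scope.

Lemma mem_state_congr (V : finType) (e : rel V) (S : V -> {set {set V}})
    (U0 : {set V}) (v : V) (s t : nat) :
  (forall u, e v u -> (u \in state e S U0 s) = (u \in state e S U0 t)) ->
  (v \in state e S U0 s.+1) = (v \in state e S U0 t.+1).
Proof.
move=> eq_st; rewrite /state !iterS [LHS]inE [RHS]inE.
suff -> : nbhd e v :&: state e S U0 s = nbhd e v :&: state e S U0 t by [].
by apply/setP => u; rewrite !inE; case: (boolP (e v u)) => //= /eq_st.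
Qed.

Lemma mem_state_threshold (V : finType) (e : rel V) (S : V -> {set {set V}})
    (U0 : {set V}) (v : V) (r : int) (t : nat) :
  S v = [set A in powerset (nbhd e v) | (r <= (#|A|)%:Z)%R] ->
  (v \in state e S U0 t.+1) = (r <= (#|nbhd e v :&: state e S U0 t|)%:Z)%R.
Proof. by move=> Sv; rewrite /state iterS inE Sv !inE subsetIl. Qed.

Lemma card_nbhdI (V : finType) (e : rel V) (v v1 : V) (U : {set V}) :
  ((#|nbhd e v :&: U|)%:Z =
   \sum_(j | j != v1) (e v j)%:Z * (j \in U)%:Z
   + (e v v1)%:Z * (v1 \in U)%:Z)%R.
Proof.
rewrite -natz -sum1_card big_mkcond natr_sum (bigD1 v1) //= [LHS]addrC !inE.
congr (_ + _)%R; last by case: (e v v1); case: (v1 \in U).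
by apply: eq_bigr => j _; rewrite !inE; case: (e v j); case: (j \in U).
Qed.

Lemma period2_away (V : finType) (e : rel V) (v1 : V) (S : V -> {set {set V}})
    (U0 : {set V}) (N p : nat) :
  symmetric e -> (forall v, v != v1 -> threshold_rule e S v) ->
  0 < p -> periodic_from (state e S U0) N p ->
  forall t v, N <= t -> v != v1 -> ~~ e v v1 ->
    (v \in state e S U0 t.+2) = (v \in state e S U0 t).
Proof.
move=> e_sym S_thr p_gt0 perU.
have [r rP] : exists r : V -> int, forall v, v != v1 ->
    S v = [set A in powerset (nbhd e v) | (r v <= (#|A|)%:Z)%R].
  apply: (fin_all_exists (P := fun v r => v != v1 -> S v =
    [set A in powerset (nbhd e v) | (r <= (#|A|)%:Z)%R])) => v.
  (* The rule at [v1] need not come from a threshold; 0 is a default value there. *)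
  by have [->|/S_thr[r Sr]] := eqVneq v v1; [exists 0%R | exists r].
pose x t v : int := ((v \in state e S U0 t)%:Z)%R.
pose a i j : int := (2 * (e i j)%:Z)%R.
(* Everything is doubled to keep the shifted thresholds integral.  [h t v] is odd
   when [v] is not adjacent to [v1]; otherwise [h t v = 0] is the exact tie. *)
pose c v : int := (1 + (e v v1)%:Z - 2 * r v)%R.
pose h t v : int := (\sum_(j | j != v1) a v j * x t j + c v)%R.
have hE t v : h t v = (2 * ((#|nbhd e v :&: state e S U0 t|)%:Z
    - (e v v1)%:Z * (v1 \in state e S U0 t)%:Z) + c v)%R.
  rewrite (card_nbhdI e v v1) addrK mulr_sumr; congr (_ + _)%R.
  by apply: eq_bigr => j _; rewrite /a /x mulrA.
(* Whatever the opinion of [v1], [h t.+1 v] is nonnegative if [v] is +1 at time [t.+2] and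
   nonpositive otherwise, and so is [x t.+2 v - x t v]. *)
have drift_ge0 t v : v != v1 -> (0 <= (x t.+2 v - x t v) * h t.+1 v)%R.
  move=> nv; rewrite hE /c /x (mem_state_threshold U0 t.+1 (rP v nv)).
  set k := #|_|.
  by case: (e v v1); case: (v1 \in _); case: (v \in _); case: leP; nia.
have perx v : periodic_from (x^~ v) N p by move=> t leNt; rewrite /x perU.
move=> t v leNt nv nev.
have a_sym i j : a i j = a j i by rewrite /a e_sym.
have /eqP := goles_olivos a_sym p_gt0 perx drift_ge0 leNt nv.
rewrite -/(h t.+1 v) mulf_eq0 => /orP[|/eqP]; last first.
  by rewrite hE /c (negbTE nev); lia.
by rewrite /x; case: (v \in _); case: (v \in _).
Qed.

(** In steps of two, a bit that flips twice is back at its start, and one that fails to flip once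
    never flips again. A flip followed by a stop is impossible, since periodicity must bring back
    [u t]. *)
Lemma periodic4_of_stay (u : nat -> bool) (N p : nat) :
  0 < p -> periodic_from u N p ->
  (forall t, N <= t -> u t.+2 = u t -> u t.+4 = u t.+2) ->
  periodic_from u N 4.
Proof.
move=> p_gt0 peru stay t leNt; rewrite !addnS addn0.
have [eq2|neq2] := eqVneq (u t.+2) (u t); first by rewrite stay.
have [eq4|neq4] := eqVneq (u t.+4) (u t.+2); last first.
  by case: (u t) (u t.+2) (u t.+4) neq2 neq4 => [] [] [].
have const k : u (t.+2 + k * 2) = u t.+2 /\ u (t.+4 + k * 2) = u t.+2.
  elim: k => [|k [IH1 IH2]]; first by rewrite !addn0.
  have -> : t.+2 + k.+1 * 2 = t.+4 + k * 2 by lia.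
  have -> : t.+4 + k.+1 * 2 = (t.+2 + k * 2).+4 by lia.
  split=> //; rewrite stay; last 1 first.
  - by rewrite IH1 -IH2; congr u; lia.
  - by rewrite -IH2; congr u; lia.
  by lia.
(* The time [t.+2 + p.-1 * 2] equals [t + 2 * p]. *)
have /negP[] := neq2; apply/eqP; rewrite -(proj1 (const p.-1)).
rewrite -(periodic_from_mul 2 peru leNt); congr u; lia.
Qed.

Theorem theorem2 (V : finType) (e : rel V) (v1 : V) (S : V -> {set {set V}})
    (U0 : {set V})
    (e_sym : symmetric e) (e_irr : irreflexive e)
    (v1_nbhd_indep : forall u w : V,
       u \in nbhd e v1 -> w \in nbhd e v1 -> u != w -> ~~ e u w)
    (S_rule : update_rule e S)
    (S_threshold : forall v : V, v != v1 -> threshold_rule e S v) :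
  exists T p : nat,
    p \in [:: 1; 2; 4] /\ cycle_length_from (state e S U0) T p.
Proof.
have [N [p [p_gt0 perU]]] := iter_eventually_periodic (step e S) U0.
have away2 := period2_away e_sym S_threshold p_gt0 perU.
pose u t := v1 \in state e S U0 t.
(* Independence enters here: apart from [v1], a neighbour of [v1] sees only vertices to which
   [away2] applies. *)
have away_nbr i j : e v1 i -> e i j -> j != v1 -> ~~ e j v1.
  move=> e1i eij nj; apply/negP => ej1; have neij : i != j.
    by apply: contraTneq eij => ->; rewrite e_irr.
  by have /negP[] : ~~ e i j by apply: v1_nbhd_indep; rewrite ?inE // e_sym.
have nbr_step t i : N <= t -> e v1 i -> u t.+2 = u t ->
    (i \in state e S U0 t.+3) = (i \in state e S U0 t.+1).
  move=> leNt e1i equ; apply: mem_state_congr => j eij.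
  by have [->|nj] := eqVneq j v1; last exact: away2 (away_nbr i j e1i eij nj).
have per_u : periodic_from u N 4.
  apply: (periodic4_of_stay p_gt0) => [t leNt|t leNt equ].
    by rewrite /u /state perU.
  (* A repetition at [v1] reaches its neighbours one step later and returns to [v1] after another
     step, whatever the rule at [v1]. *)
  by apply: mem_state_congr => i e1i; apply: nbr_step.
have per_away t j : N <= t -> j != v1 ->
    (j \in state e S U0 t.+1.+4) = (j \in state e S U0 t.+1).
  move=> leNt nj; have [e1j|nej] := boolP (e v1 j); last first.
    by rewrite !away2 // 1?e_sym //; lia.
  apply: mem_state_congr => k ejk.
  have [->|nk] := eqVneq k v1.
    by have := per_u t leNt; rewrite !addnS addn0.
  by rewrite !away2 ?(away_nbr j k) //; lia.
(* The neighbours of [v1] lag one step behind it, so their period 4 is obtained only from [N.+1]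
   on. *)
exists N.+1; apply: cycle_length_iter4 => -[//|t] leNt.
rewrite addSn !addnS addn0; apply/setP => i.
have [->|ni] := eqVneq i v1; last exact: per_away.
by have := per_u t.+1 (leqW leNt); rewrite addSn !addnS addn0.
Qed.
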